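(* Let $P$ be an OTM-program, $\kappa$ a cardinal, and let $w\in\{0,1\}^{**}$ be a word of minimal length among all words $v$ such that the computation of $P^{v}$ uses $\kappa$ many scratch tape cells. Then $\mathrm{card}(|w|)\leq\kappa$.
   Context: $\{0,1\}^{**}$ is the class of sequences of ordinal length over $\{0,1\}$; $|w|$ is the length of $w$. An ordinal Turing machine (OTM, in the sense of Koepke) has an input tape and a scratch tape, each with cells indexed by all ordinals and containing $0$ or $1$, a head on each tape, and runs a finite program $P$ for transfinitely many steps: successor steps act as for ordinary Turing machines (moving left from a limit position sets the head to $0$); at limit times the inner state, each head position and each cell content are the inferior limits of their previous values. $P^{w}$ denotes the computation of $P$ with $w$ written on the input tape. ''$P^{w}$ uses $\kappa$ many scratch tape cells'' means the set of scratch tape cells visited during the computation has cardinality $\kappa$.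
   Formalization: The cardinal κ is assumed infinite: for finite κ≥1 the claim fails (a machine can inspect a far input cell and use exactly κ scratch cells only if it holds 1, forcing |w|>κ). The input tape is taken to be read-only. *)

(* Defs.v *)
From HB Require Import structures.
From mathcomp Require Import all_boot all_order.
From mathcomp Require Import boolp classical_sets functions cardinality.

Set Implicit Arguments.
Unset Strict Implicit.
Unset Printing Implicit Defensive.

Import Order.TTheory.
Local Open Scope classical_set_scope.
Local Open Scope card_scope.
Local Open Scope order_scope.
Local Open Scope quotient_scope.

(* The class of all ordinals is taken relative to the universe [small], whose
   types play the role of sets.  A well-founded small-branching tree [node f]
   denotes the ordinal sup_a (f a + 1); ordinals are the trees up to equality
   of the denoted ordinals.  The lemmas [on_wf], [on_bounded] and
   [on_small_seg] below characterise the resulting well-order: every small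
   family of ordinals is strictly bounded and every ordinal has only a small
   family of predecessors. *)
Definition small := Type.

Inductive tree := node (A : small) of A -> tree.

Fixpoint tle (x y : tree) {struct x} : Prop :=
  let: node _ f := x in let: node _ g := y in
  forall a, exists b, tle (f a) (g b).

Definition tlt (x y : tree) : Prop := let: node _ g := y in exists b, tle x (g b).

Lemma tle_refl x : tle x x.
Proof. by elim: x => A f IH a; exists a; exact: IH. Qed.

Lemma tle_trans y x z : tle x y -> tle y z -> tle x z.
Proof.
elim: x y z => A f IH [B g] [D h] /= fg gh a.
have [b ab] := fg a; have [d bd] := gh b.
by exists d; exact: IH ab bd.
Qed.

Lemma tle_total x y : tle x y \/ tle y x.
Proof.
elim: x y => A f IH [B g].
have [le_fg|/existsNP[a /forallNP nle]] := pselect (tle (node f) (node g)).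
  by left.
by right=> b; exists a; have [/nle|] := IH a (g b).
Qed.

Lemma tlt_irr x : ~ tlt x x.
Proof.
elim: x => D h IH [d]; case E: (h d) => [K k] hd; apply: (IH d).
by rewrite [X in tlt _ X]E; exact: hd.
Qed.

Lemma tle_lt_trans y x z : tle x y -> tlt y z -> tlt x z.
Proof. by case: z => D h xy [d yd]; exists d; exact: tle_trans xy yd. Qed.

Lemma tltNge x y : tlt x y <-> ~ tle y x.
Proof.
split=> [xy yx|]; first by apply: (@tlt_irr y); exact: tle_lt_trans yx xy.
elim: x y => A f IH [B g] /existsNP[b nb]; exists b.
have lt_fa a : tlt (f a) (g b) by apply: IH => le; apply: nb; exists a.
by case: (g b) lt_fa.
Qed.

Definition tequiv : rel tree := fun x y => `[< tle x y >] && `[< tle y x >].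

Lemma tequiv_refl : reflexive tequiv.
Proof. by move=> x; apply/andP; split; apply/asboolP/tle_refl. Qed.

Lemma tequiv_sym : symmetric tequiv.
Proof. by move=> x y; rewrite /tequiv andbC. Qed.

Lemma tequiv_trans : transitive tequiv.
Proof.
move=> y x z /andP[/asboolP xy /asboolP yx] /andP[/asboolP yz /asboolP zy].
by apply/andP; split; apply/asboolP; apply: tle_trans; eassumption.
Qed.

Canonical tequiv_equiv := EquivRel tequiv tequiv_refl tequiv_sym tequiv_trans.

HB.instance Definition _ := gen_eqMixin tree.
HB.instance Definition _ := gen_choiceMixin tree.

Definition On := {eq_quot tequiv}.
HB.instance Definition _ := Choice.on On.
HB.instance Definition _ := EqQuotient.on On.

Definition on_le : rel On := fun a b => `[< tle (repr a) (repr b) >].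

Lemma on_le_refl : reflexive on_le.
Proof. by move=> a; apply/asboolP/tle_refl. Qed.

Lemma on_le_anti : antisymmetric on_le.
Proof.
move=> a b /andP[ab ba]; rewrite -[a]reprK -[b]reprK; apply/eqmodP.
exact/andP.
Qed.

Lemma on_le_trans : transitive on_le.
Proof.
by move=> b a c /asboolP ab /asboolP bc; apply/asboolP; exact: tle_trans ab bc.
Qed.

Fact on_display : Order.disp_t. Proof. exact: (Order.Disp tt tt). Qed.

HB.instance Definition _ :=
  Order.Le_isPOrder.Build on_display On on_le_refl on_le_anti on_le_trans.

Lemma on_le_total : total (<=%O : rel On).
Proof.
move=> a b; apply/orP.
by have [|] := tle_total (repr a) (repr b) => h; [left|right]; apply/asboolP.
Qed.

HB.instance Definition _ :=
  Order.POrder_isTotal.Build on_display On on_le_total.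

Definition oord (x : tree) : On := \pi_On x.

Lemma repr_oord x : tle (repr (oord x)) x /\ tle x (repr (oord x)).
Proof.
have /eqmodP/andP[/asboolP ? /asboolP ?] : repr (oord x) = x %[mod On].
  by rewrite reprK.
by [].
Qed.

Lemma oord_le x y : (oord x <= oord y) = `[< tle x y >].
Proof.
have [x1 x2] := repr_oord x; have [y1 y2] := repr_oord y.
apply/asboolP/asboolP => le; first exact: tle_trans (tle_trans x2 le) y1.
exact: tle_trans (tle_trans x1 le) y2.
Qed.

Lemma oord_lt x y : (oord x < oord y) = `[< tlt x y >].
Proof.
rewrite ltNge oord_le; apply/negP/asboolP => [|/tltNge nle /asboolP //].
by move=> nle; apply/tltNge => le; apply: nle; apply/asboolP.
Qed.

Lemma on_wf : well_founded (fun a b : On => a < b).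
Proof.
move=> a; rewrite -[a]reprK -/(oord _).
suff acc x y : tle y x -> Acc (fun a b : On => a < b) (oord y).
  exact/acc/tle_refl.
elim: x y => A f IH y yx; constructor=> b.
rewrite -[b]reprK -/(oord _) oord_lt => /asboolP.
case: y yx => B g gf [c bc]; have [d cd] := gf c.
exact: IH (tle_trans bc cd).
Qed.

Lemma on_bounded (A : small) (f : A -> On) : exists b, forall a, f a < b.
Proof.
exists (oord (node (fun a => repr (f a)))) => a.
rewrite -[f a in X in X < _]reprK -/(oord _) oord_lt; apply/asboolP.
by exists a; exact: tle_refl.
Qed.

Fixpoint subtrees (x : tree) : small :=
  let: node A f := x in {a : A & option (subtrees (f a))}.

Lemma on_small_seg (b : On) :
  exists (A : small) (f : A -> On), forall a, a < b <-> exists i, f i = a.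
Proof.
suff [f hf] : exists f : subtrees (repr b) -> tree,
    forall x, tlt x (repr b) <-> exists i, oord (f i) = oord x.
  exists (subtrees (repr b)), (fun i => oord (f i)) => a.
  by rewrite -[a]reprK -[b in X in X <-> _]reprK -!/(oord _) oord_lt;
     split=> [/asboolP/hf|/hf/asboolP].
elim: (repr b) => {b} A g IH.
have [h hh] : exists h : forall a, subtrees (g a) -> tree, forall a x,
    tlt x (g a) <-> exists i, oord (h a i) = oord x.
  by exists (fun a => projT1 (cid (IH a))) => a; exact: projT2 (cid (IH a)).
exists (fun i => let: existT a o := i in if o is Some j then h a j else g a).
move=> x; split=> [[a]|[[a [j|]]] ij].
- have [xa _|nle xa] := pselect (tlt x (g a)).
    by have /hh[j ij] := xa; exists (existT _ a (Some j)).
  exists (existT _ a None); apply/eqP; rewrite eq_le !oord_le.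
  apply/andP; split; apply/asboolP => //.
  by apply: contrapT => /tltNge.
- have : tlt x (g a) by apply/hh; exists j.
  move=> xa; exists a; have [//|ax] := tle_total x (g a).
  by case: (@tlt_irr x); apply/tltNge => _; move/tltNge: xa; apply.
- by exists a; have := oord_le x (g a); rewrite -ij lexx => /esym/asboolP.
Qed.

Definition ozero : On := oord (@node False (fun i => match i with end)).

Definition osucc (a : On) : On := oord (@node unit (fun=> repr a)).

Lemma ozero_le a : ozero <= a.
Proof. by rewrite -[a]reprK -/(oord _) oord_le; apply/asboolP; case: (repr a) => B g []. Qed.

Lemma lt_osucc a b : (a < osucc b) = (a <= b).
Proof.
by rewrite -[a in LHS]reprK -/(oord _) oord_lt /=; apply/asboolP/asboolP => [[]|].
Qed.

(* 0 is not a limit. *)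
Definition olimit (a : On) : Prop := ozero < a /\ forall b, b < a -> osucc b < a.

Lemma on_cases a : [\/ a = ozero, exists b, a = osucc b | olimit a].
Proof.
have [->|a0] := eqVneq a ozero; first by constructor 1.
have [[b ->]|nS] := pselect (exists b, a = osucc b); first by constructor 2; exists b.
constructor 3; split=> [|b ba]; first by rewrite lt_neqAle eq_sym a0 ozero_le.
rewrite ltNge; apply/negP => ab; apply: nS; exists b; apply/eqP.
by rewrite eq_le ab /= leNgt lt_osucc leNgt ba.
Qed.

Lemma osucc_inj : injective osucc.
Proof. by move=> a b ab; apply/eqP; rewrite eq_le -!lt_osucc -ab {2}ab !lt_osucc !lexx. Qed.

Lemma olimit_neq0 a : olimit a -> a <> ozero.
Proof. by move=> [+ _] a0; rewrite a0 ltxx. Qed.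

Lemma olimit_neqS a b : olimit a -> a <> osucc b.
Proof. by move=> [_ aS] ab; have := aS b; rewrite ab ltxx lt_osucc lexx => /(_ isT). Qed.

Definition seg (a : On) : set On := [set b | b < a].

(* Initial ordinals. *)
Definition is_cardinal (k : On) : Prop := forall b, b < k -> ~ (seg b #= seg k).

(* l is the inferior limit sup_(s < t) inf_(s <= r < t) f r. *)
Definition is_liminf d (T : porderType d) (t : On) (f : On -> T) (l : T) : Prop :=
  supremums [set m | exists2 s, s < t & infimums (f @` [set r | s <= r < t]) m] l.

Lemma eq_is_liminf d (T : porderType d) (t : On) (f g : On -> T) (l : T) :
  (forall s, s < t -> f s = g s) -> is_liminf t f l -> is_liminf t g l.
Proof.
move=> fg; have E s : f @` [set r | s <= r < t] = g @` [set r | s <= r < t].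
  by apply: eq_imagel => r /andP[_ rt]; rewrite fg.
rewrite /is_liminf (_ : [set m | _] = [set m | exists2 s, s < t &
  infimums (g @` [set r | s <= r < t]) m]) //.
by apply/seteqP; split=> m [s st hm]; exists s; rewrite // ?E // -E.
Qed.

Lemma is_liminf_inj d (T : porderType d) (t : On) (f : On -> T) (l l' : T) :
  is_liminf t f l -> is_liminf t f l' -> l = l'.
Proof. exact: is_subset1_supremums. Qed.

Lemma wf_min d (T : orderType d) (A : set T) :
  well_founded (fun x y : T => x < y) -> A !=set0 -> exists2 m, A m & lbound A m.
Proof.
move=> wfT [x Ax]; apply: contrapT => nomin; suff: ~ A x by [].
elim/(well_founded_ind wfT): x {Ax} => x IH Ax; apply: nomin; exists x => // y Ay.
by rewrite leNgt; apply/negP => /IH.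
Qed.

Lemma is_liminf_ex d (T : orderType d) (t : On) (f : On -> T) (u : T) :
  well_founded (fun x y : T => x < y) -> (forall s, s < t -> f s <= u) ->
  exists l, is_liminf t f l.
Proof.
move=> wfT fu; rewrite /is_liminf; set A := (X in supremums X).
have [l ? ?] : exists2 l, ubound A l & lbound (ubound A) l.
  apply: wf_min => //; exists u => m [s st [ms _]].
  by apply: le_trans (fu s st); apply: ms; exists s => //=; rewrite lexx.
by exists l.
Qed.

Lemma on_bounded_seg (t : On) (f : On -> On) : exists u, forall s, s < t -> f s <= u.
Proof.
have [A [g hg]] := on_small_seg t; have [u hu] := on_bounded (fun a => f (g a)).
by exists u => s /hg[a <-]; exact: ltW.
Qed.

Lemma ord_wf n : well_founded (fun i j : 'I_n => (i < j)%O).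
Proof.
move=> [i lt_in]; elim/ltn_ind: i lt_in => i IH lt_in.
by constructor=> -[j lt_jn]; rewrite ltEord => ji; apply: IH.
Qed.

Lemma bool_wf : well_founded (fun x y : bool => (x < y)%O).
Proof.
have acc0 : Acc (fun x y : bool => (x < y)%O) false.
  by constructor; case.
case; last exact: acc0.
by constructor; case=> [|_]; [rewrite ltxx|exact: acc0].
Qed.

Record word := Word { wlen : On; wsym : {b : On | b < wlen} -> bool }.

Definition input_tape (w : word) (b : On) : bool :=
  if pselect (b < wlen w) is left lt_bw then wsym (exist _ b lt_bw) else false.

Inductive move := Left | Stay | Right.

(* The first component is the new inner state, the second one the symbol
   written on the scratch tape, and the last two are the moves of the input head
   and of the scratch head.  The input tape is read-only.  [None] means that no
   instruction applies and that the machine halts. *)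
Record program := Program {
  nstate : nat;
  instr : 'I_nstate.+1 -> bool -> bool ->
    option ('I_nstate.+1 * bool * move * move)
}.

Definition pstate (P : program) := 'I_(nstate P).+1.

Record config (P : program) := Config {
  state : pstate P;
  ihead : On;
  shead : On;
  scratch : On -> bool
}.

(* The default value of [xget] makes a left move from 0 or a limit go to 0. *)
Definition move_head (m : move) (p : On) : On :=
  match m with
  | Left => xget ozero [set q | osucc q = p]
  | Stay => p
  | Right => osucc p
  end.

Definition init (P : program) : config P :=
  Config (ord0 : pstate P) ozero ozero (fun=> false).

(* A halted machine keeps its last configuration forever, which does not change
   the set of visited cells. *)
Definition step (P : program) (w : word) (c : config P) : config P :=
  match instr (state c) (input_tape w (ihead c)) (scratch c (shead c)) with
  | None => c
  | Some (q, x, mi, ms) =>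
      Config (q : pstate P) (move_head mi (ihead c)) (move_head ms (shead c))
        (fun p => if p == shead c then x else scratch c p)
  end.

Record is_computation (P : program) (w : word) (C : On -> config P) : Prop := {
  computation0 : C ozero = init P;
  computationS : forall t, C (osucc t) = step w (C t);
  computation_state : forall t, olimit t ->
    is_liminf t (fun s => state (C s) : 'I_(nstate P).+1) (state (C t));
  computation_ihead : forall t, olimit t ->
    is_liminf t (fun s => ihead (C s)) (ihead (C t));
  computation_shead : forall t, olimit t ->
    is_liminf t (fun s => shead (C s)) (shead (C t));
  computation_scratch : forall t p, olimit t ->
    is_liminf t (fun s => scratch (C s) p) (scratch (C t) p)
}.

Section ComputationExists.
Variables (P : program) (w : word).

Definition limit_config (t : On) (C : On -> config P) : config P :=
  Config (xget ord0 (is_liminf t (fun s => state (C s) : 'I_(nstate P).+1)))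
    (xget ozero (is_liminf t (fun s => ihead (C s))))
    (xget ozero (is_liminf t (fun s => shead (C s))))
    (fun p => xget false (is_liminf t (fun s => scratch (C s) p))).

Definition config_at (t : On) (C : forall s, s < t -> config P) : config P :=
  let D s := if pselect (s < t) is left st then C s st else init P in
  if t == ozero then init P else
  if pselect (exists s, t = osucc s) is left h then step w (D (projT1 (cid h)))
  else limit_config t D.

Definition computation : On -> config P := Fix on_wf (fun=> config P) config_at.

Lemma computationE t : computation t =
  config_at (fun s (_ : s < t) => computation s).
Proof.
apply: (@Fix_eq _ _ on_wf (fun=> config P) config_at) => a f g fg.
by have -> : f = g by apply: functional_extensionality_dep => s;
  apply: functional_extensionality_dep.
Qed.

Lemma is_computation_computation : is_computation w computation.
Proof.
have lim t : olimit t -> computation t =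
    limit_config t (fun s => if pselect (s < t) then computation s else init P).
  move=> lt; rewrite computationE /config_at.
  case: eqP => [/(olimit_neq0 lt)//|_]; case: pselect => [[s /(olimit_neqS lt)]|]//.
  by move=> _; congr limit_config; apply/funext => s; case: pselect.
have get d (T : orderType d) (x u : T) (p : config P -> T) (a : On) :
    well_founded (fun x y : T => x < y) ->
    (forall s, s < a -> p (computation s) <= u) ->
    is_liminf a (fun s => p (computation s)) (xget x (is_liminf a (fun s =>
      p (if pselect (s < a) then computation s else init P)))).
  move=> wfT hu; pose D s := if pselect (s < a) then computation s else init P.
  have DE s : s < a -> D s = computation s by rewrite /D; case: pselect.
  have [l hl] : exists l, is_liminf a (fun s => p (D s)) l.
    by apply: (is_liminf_ex (u := u)) => // s sa; rewrite DE //; exact: hu.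
  apply: (@eq_is_liminf _ _ _ (fun s => p (D s))) => [s sa|]; first by rewrite DE.
  by case: xgetP => [y -> //|/(_ l)].
split=> [|t|t lt|t lt|t lt|t p lt].
- by rewrite computationE /config_at eqxx.
- rewrite computationE /config_at; case: eqP => [t0|_].
    by have := ozero_le t; rewrite -t0 leNgt lt_osucc lexx.
  case: pselect => [h|[]]; last by exists t.
  by case: (cid h) => s /= /osucc_inj <-; case: pselect => //; rewrite lt_osucc.
- rewrite (lim t lt) /=.
  apply: (get _ _ _ ord_max (@state P)) => [|s _]; first exact: ord_wf.
  exact: leq_ord.
- have [u hu] := on_bounded_seg t (fun s => ihead (computation s)).
  rewrite (lim t lt) /=; apply: (get _ _ _ u (@ihead P)); last exact: hu.
  exact: on_wf.
- have [u hu] := on_bounded_seg t (fun s => shead (computation s)).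
  rewrite (lim t lt) /=; apply: (get _ _ _ u (@shead P)); last exact: hu.
  exact: on_wf.
- rewrite (lim t lt) /=.
  apply: (get _ _ _ true (fun c => scratch c p)) => [|s _]; first exact: bool_wf.
  by case: scratch.
Qed.

Lemma is_computation_inj (C D : On -> config P) :
  is_computation w C -> is_computation w D -> C = D.
Proof.
move=> [C0 CS Cq Ci Cs Cx] [D0 DS Dq Di Ds Dx]; apply/funext => t.
elim/(well_founded_ind on_wf): t => t IH.
have [->|[s ts]|lt] := on_cases t; first by rewrite C0 D0.
  by rewrite ts CS DS IH // ts lt_osucc.
have := (Cq t lt, Ci t lt, Cs t lt); have := (Dq t lt, Di t lt, Ds t lt).
have := fun p => Cx t p lt; have := fun p => Dx t p lt.
case: (C t) (D t) => [q i s x] [q' i' s' x'] /= hx' hx [[hq' hi'] hs'] [[hq hi] hs].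
congr Config.
- by apply: is_liminf_inj hq'; apply: eq_is_liminf hq => r /IH ->.
- by apply: is_liminf_inj hi'; apply: eq_is_liminf hi => r /IH ->.
- by apply: is_liminf_inj hs'; apply: eq_is_liminf hs => r /IH ->.
- apply/funext => p; apply: is_liminf_inj (hx' p).
  by apply: eq_is_liminf (hx p) => r /IH ->.
Qed.

End ComputationExists.

Definition visited (P : program) (w : word) : set On :=
  range (fun t => shead (computation P w t)).

Definition uses (P : program) (w : word) (k : On) : Prop := visited P w #= seg k.

(* Main.v *)
Require Import Defs.
From HB Require Import structures.
From mathcomp Require Import all_boot all_order.
From mathcomp Require Import boolp classical_sets functions cardinality.

(* Let V be the set of scratch cells visited by the computation C of P on w.
   Since V is a set, C enters a loop: there are times t1 < t2 with the same state,
   scratch head and scratch tape, all of which stay above (componentwise) their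
   value at t1 in between, and the input head either returns to its position a at
   t1 without going below a, or stays above a >= |w|, where it only reads 0.  Both
   times realise the inferior limit of C over all ordinals.  Such a loop repeats
   forever, possibly with the input head translated, so that nothing new is
   visited after t2.

   Take a set H of at most kappa ordinals that contains V, t1, t2, |w| and is
   closed under the functions witnessing the behaviour of C (input head positions,
   first visits, witnesses of inferior limits).  The collapse pi of H maps C to the
   computation on the word v of length pi |w| with v (pi x) = w x, and fixes V
   because V is an initial segment of the ordinals.  The collapsed computation has
   the loop (pi t1, pi t2), hence it visits exactly V, and minimality gives
   |w| <= |v| = pi |w|, where pi |w| has at most kappa predecessors. *)

Set Implicit Arguments.
Unset Strict Implicit.
Unset Printing Implicit Defensive.

Import Order.TTheory.
Local Open Scope classical_set_scope.
Local Open Scope card_scope.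
Local Open Scope order_scope.

(** * Small sets of ordinals and ranks *)

HB.instance Definition _ := isPointed.Build On ozero.

Lemma on_min (A : set On) : A !=set0 -> exists2 m, A m & lbound A m.
Proof. exact/wf_min/on_wf. Qed.

Lemma osucc_le a b : (osucc a <= b) = (a < b).
Proof. by rewrite !leNgt lt_osucc -ltNge. Qed.

Definition is_small T (A : set T) :=
  exists (I : small) (f : I -> T), A `<=` range f.

Lemma small_seg a : is_small (seg a).
Proof.
have [I [f fP]] := on_small_seg a; exists I, f => b /fP[i <-].
by exists i.
Qed.

Lemma sub_small T (A B : set T) : A `<=` B -> is_small B -> is_small A.
Proof. by move=> AB [I [f Bf]]; exists I, f; exact: subset_trans AB Bf. Qed.

Lemma small_image T U (f : T -> U) (A : set T) : is_small A -> is_small (f @` A).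
Proof.
move=> [I [g Ag]]; exists I, (f \o g) => _ [x /Ag[i _ <-] <-].
by exists i.
Qed.

Lemma smallX T U (A : set T) (B : set U) :
  is_small A -> is_small B -> is_small (A `*` B).
Proof.
move=> [I [f Af]] [J [g Bg]]; exists (I * J)%type, (fun ij => (f ij.1, g ij.2)).
by move=> [x y] [/= /Af[i _ <-] /Bg[j _ <-]]; exists (i, j).
Qed.

Lemma smallU T (A B : set T) : is_small A -> is_small B -> is_small (A `|` B).
Proof.
move=> [I [f Af]] [J [g Bg]].
exists (I + J)%type, (fun ij => match ij with inl i => f i | inr j => g j end).
by move=> x [/Af[i _ <-]|/Bg[j _ <-]]; [exists (inl i)|exists (inr j)].
Qed.

Lemma small_bounded (A : set On) : is_small A -> exists u, forall a, A a -> a < u.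
Proof.
move=> [I [f Af]]; have [u fu] := on_bounded f.
by exists u => _ /Af[i _ <-].
Qed.

Definition strict_sup (A : set On) : On :=
  xget ozero [set u | (forall a, A a -> a < u) /\
    forall v, (forall a, A a -> a < v) -> u <= v].

Lemma strict_supP (A : set On) : is_small A ->
  (forall a, A a -> a < strict_sup A) /\ forall v, (forall a, A a -> a < v) -> strict_sup A <= v.
Proof.
move=> /small_bounded smA; rewrite /strict_sup; case: xgetP => [u -> //|noU].
by have [u Au umin] := @on_min [set u | forall a, A a -> a < u] smA; case: (noU u).
Qed.

Section Rank.
Context {T : Type} (R : T -> T -> Prop) (wfR : well_founded R) (b : On).
Hypothesis smallR : forall x, is_small [set y | R y x].

Definition rank : T -> On := Fix wfR (fun=> On) (fun x r =>
  strict_sup (seg b `|` [set c | exists y (yx : R y x), r y yx = c])).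

Lemma rankE x : rank x = strict_sup (seg b `|` rank @` [set y | R y x]).
Proof.
rewrite [LHS]Fix_eq => [|{}x f g fg]; last first.
  by have -> : f = g by apply: functional_extensionality_dep => y;
    apply: functional_extensionality_dep.
congr (strict_sup (_ `|` _)); apply/seteqP; split=> [_ [y [yx <-]]|_ [y yx <-]].
  by exists y.
by exists y, yx.
Qed.

Let rankP x := strict_supP (smallU (small_seg b) (small_image rank (smallR x))).

Lemma rank_base x : b <= rank x.
Proof.
rewrite leNgt; apply/negP => lt; have [+ _] := rankP x.
by move=> /(_ (rank x)); rewrite -rankE ltxx => H; have := H (or_introl lt).
Qed.

Lemma rank_lt x y : R y x -> rank y < rank x.
Proof.
by move=> yx; rewrite [ltRHS]rankE; apply: (rankP x).1; right; exists y.
Qed.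

Lemma rank_le x c : b <= c -> (forall y, R y x -> rank y < c) -> rank x <= c.
Proof.
move=> bc h; rewrite rankE; apply: (rankP x).2 => a [ab|[y /h + <-//]].
exact: lt_le_trans bc.
Qed.

Hypothesis transR : forall y x z, R x y -> R y z -> R x z.

Lemma rank_onto x c : b <= c -> c < rank x -> exists2 y, R y x & rank y = c.
Proof.
move=> bc; elim/(well_founded_ind wfR): x => x IH cx.
have [[y yx cy]|no] := pselect (exists2 y, R y x & c <= rank y).
  have [<-|ne] := eqVneq (rank y) c; first by exists y.
  have [|z zy <-] := IH y yx; first by rewrite lt_neqAle eq_sym ne.
  by exists z => //; exact: transR yx.
suff : rank x <= c by rewrite leNgt cx.
by apply: rank_le => // y yx; rewrite ltNge; apply/negP => cy; apply: no; exists y.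
Qed.

End Rank.

(** * Infinite ordinals absorb their square *)

Lemma card_le_inj T U (A : set T) (B : set U) (f : T -> U) :
  (forall x, A x -> B (f x)) -> (forall x y, A x -> A y -> f x = f y -> x = y) ->
  A #<= B.
Proof.
move=> AB inj; have fA : f @` A #= A.
  by apply: inj_card_eq => x y /set_mem Ax /set_mem Ay; exact: inj.
apply: (@card_le_trans _ _ _ (f @` A)).
  by move: fA; rewrite card_eq_le => /andP[].
by apply: subset_card_le => _ [x Ax <-]; exact: AB.
Qed.

Lemma card_le_exinj T (U : pointedType) (A : set T) (B : set U) :
  A #<= B -> exists f : T -> U, (forall x, A x -> B (f x)) /\
    forall x y, A x -> A y -> f x = f y -> x = y.
Proof.
move=> /pcard_leP[f]; exists f; split=> [x Ax|x y Ax Ay]; first exact: funS.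
by apply: inj; exact/mem_set.
Qed.

Lemma card_leX T1 T2 (U1 U2 : pointedType) (A1 : set T1) (A2 : set T2)
    (B1 : set U1) (B2 : set U2) :
  A1 #<= B1 -> A2 #<= B2 -> A1 `*` A2 #<= B1 `*` B2.
Proof.
move=> /card_le_exinj[f [fAB finj]] /card_le_exinj[g [gAB ginj]].
apply: (@card_le_inj _ _ _ _ (fun x => (f x.1, g x.2))) => [[x y] [/= Ax Ay]|].
  by split; [exact: fAB|exact: gAB].
move=> [x y] [x' y'] [/= Ax Ay] [/= Ax' Ay'] [fx gy].
by rewrite (finj x x') // (ginj y y').
Qed.

Lemma sub_seg a b : a <= b -> seg a `<=` seg b.
Proof. by move=> ab c /= ca; exact: lt_le_trans ab. Qed.

Lemma segS a : seg (osucc a) = seg a `|` [set a].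
Proof.
apply/seteqP; split=> b; rewrite /seg /= lt_osucc le_eqVlt.
  by move=> /orP[/eqP ->|]; [right|left].
by move=> [->|->]; rewrite ?orbT ?eqxx.
Qed.

Lemma seg0 : seg ozero = set0.
Proof. by apply/seteqP; split=> // b; rewrite /seg /= ltNge ozero_le. Qed.

Lemma infinite_seg_neq0 a : infinite_set (seg a) -> a <> ozero.
Proof. by move=> + a0; rewrite a0 seg0; apply; exact: finite_set0. Qed.

Lemma finite_segS a : finite_set (seg a) -> finite_set (seg (osucc a)).
Proof. by move=> fa; rewrite segS finite_setU; split=> //; exact: finite_set1. Qed.

Lemma card_segS a : infinite_set (seg a) -> seg (osucc a) #<= seg a.
Proof.
move=> infa.
have a0 : ozero < a.
  by rewrite lt_neqAle ozero_le andbT; apply/eqP/nesym/infinite_seg_neq0.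
(* Hilbert's hotel: shift the finite ordinals and send a to 0. *)
pose f b := if b == a then ozero else
  if pselect (finite_set (seg b)) then osucc b else b.
have fa : f a = ozero by rewrite /f eqxx.
have fS b : b < a -> finite_set (seg b) -> f b = osucc b.
  by move=> ba fb; rewrite /f lt_eqF //; case: pselect.
have fI b : b < a -> infinite_set (seg b) -> f b = b.
  by move=> ba fb; rewrite /f lt_eqF //; case: pselect.
have S0 b : osucc b <> ozero.
  by move=> b0; have := ozero_le b; rewrite -b0 osucc_le ltxx.
apply: (@card_le_inj _ _ _ _ f) => [b|b c]; rewrite /seg /= ?lt_osucc.
- rewrite le_eqVlt => /orP[/eqP ->|ba]; first by rewrite fa.
  have [fb|ib] := pselect (finite_set (seg b)); last by rewrite fI.
  rewrite fS // lt_neqAle osucc_le ba andbT; apply/eqP => Sb.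
  by apply: infa; rewrite -Sb; exact: finite_segS.
- rewrite !le_eqVlt => /orP[/eqP ->|ba] /orP[/eqP ->|ca] //; rewrite ?fa.
  + have [fc|ic] := pselect (finite_set (seg c)).
      by rewrite fS // => /esym/S0.
    by rewrite fI // => /esym/(infinite_seg_neq0 ic).
  + have [fb|ib] := pselect (finite_set (seg b)); first by rewrite fS // => /S0.
    by rewrite fI // => /(infinite_seg_neq0 ib).
  + have [fb|ib] := pselect (finite_set (seg b));
    have [fc|ic] := pselect (finite_set (seg c)).
    * by rewrite !fS //; exact: osucc_inj.
    * by rewrite fS // fI // => bc; case: ic; rewrite -bc; exact: finite_segS.
    * by rewrite fI // fS // => bc; case: ib; rewrite bc; exact: finite_segS.
    * by rewrite !fI.
Qed.

Definition maxlex (x y : On * On) : Prop :=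
  let mx := Order.max x.1 x.2 in let my := Order.max y.1 y.2 in
  mx < my \/ mx = my /\ (x.1 < y.1 \/ x.1 = y.1 /\ x.2 < y.2).

Lemma maxlex_wf : well_founded maxlex.
Proof.
suff H m a b : Order.max a b = m -> Acc maxlex (a, b) by case=> a b; exact: H.
elim/(well_founded_ind on_wf): m a b => m IHm a.
elim/(well_founded_ind on_wf): a => a IHa b.
elim/(well_founded_ind on_wf): b => b IHb mE.
constructor=> -[c d] [|[]] /=; first by rewrite mE => lt; exact: IHm lt _ _ erefl.
rewrite mE => cdm [ca|[ca db]]; first exact: IHa.
by subst c; exact: IHb.
Qed.

Lemma maxlex_trans y x z : maxlex x y -> maxlex y z -> maxlex x z.
Proof.
rewrite /maxlex => -[xy|[-> xy]] [yz|[<- yz]].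
- by left; exact: lt_trans yz.
- by left.
- by left.
right; split=> //; case: xy => [xy|[-> xy]]; case: yz => [yz|[<- yz]].
- by left; exact: lt_trans yz.
- by left.
- by left.
by right; split=> //; exact: lt_trans yz.
Qed.

Lemma maxlex_total x y : [\/ x = y, maxlex x y | maxlex y x].
Proof.
rewrite /maxlex; case: x y => [a b] [c d] /=.
case: (ltgtP (Order.max a b) (Order.max c d)) => mm.
- by apply: Or32; left.
- by apply: Or33; left.
case: (ltgtP a c) mm => [ac|ca|->] mm.
- by apply: Or32; right; split; [|left].
- by apply: Or33; right; split; [|left].
case: (ltgtP b d) => [bd|db|->].
- by apply: Or32; right; split; [|right].
- by apply: Or33; right; split; [|right].
- exact: Or31.
Qed.

Lemma maxlex_pred x m : Order.max x.1 x.2 <= m ->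
  [set y | maxlex y x] `<=` seg (osucc m) `*` seg (osucc m).
Proof.
move=> xm y yx; have : Order.max y.1 y.2 <= m.
  by apply: le_trans xm; case: yx => [/ltW|[->]].
by rewrite ge_max => /andP[? ?]; split; rewrite /seg /= lt_osucc.
Qed.

Lemma small_maxlex x : is_small [set y | maxlex y x].
Proof. by apply: sub_small (maxlex_pred (lexx _)) _; apply: smallX; exact: small_seg. Qed.

(* If m is not in bijection with a smaller ordinal, the max-lex order on m x m
   has order type at most m, since every proper initial segment is contained in
   some (c+1) x (c+1) with c < m. *)
Theorem card_segX m : infinite_set (seg m) -> seg m `*` seg m #<= seg m.
Proof.
elim/(well_founded_ind on_wf): m => m IH infm.
have [[b bm mb]|nob] := pselect (exists2 b, b < m & seg m #<= seg b).
  have infb : infinite_set (seg b) by move=> fb; apply: infm; exact: card_le_finite mb fb.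
  apply: card_le_trans (card_leX mb mb) _.
  by apply: card_le_trans (IH b bm infb) _; exact/subset_card_le/sub_seg/ltW.
pose rk := rank maxlex_wf ozero.
apply: (@card_le_inj _ _ _ _ rk) => [x [/= x1 x2]|x y _ _ xy]; last first.
  have lt_rk := rank_lt maxlex_wf ozero small_maxlex.
  have [//|/lt_rk|/lt_rk] := maxlex_total x y;
  by rewrite -/rk xy ltxx.
rewrite /seg /= ltNge; apply/negP => mrk.
set c := Order.max x.1 x.2; have cm : c < m by rewrite gt_max x1.
have seg_c : seg m #<= seg (osucc c) `*` seg (osucc c).
  apply: (@card_le_trans _ _ _ [set y | maxlex y x]); last exact/subset_card_le/maxlex_pred.
  apply: (@card_le_trans _ _ _ (rk @` [set y | maxlex y x])); last exact: card_image_le.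
  apply: subset_card_le => a /= am.
  have [|y yx <-] := rank_onto small_maxlex maxlex_trans (ozero_le a) (_ : a < rk x).
    exact: lt_le_trans mrk.
  by exists y.
have [fc|infc] := pselect (finite_set (seg c)).
  by apply: infm; apply: card_le_finite seg_c _; apply: finite_setX; exact: finite_segS.
apply: nob; exists c => //; apply: card_le_trans seg_c _.
by apply: card_le_trans (IH c cm infc); apply: card_leX; exact: card_segS.
Qed.

(** * Hulls and inferior limits *)

Inductive term := Leaf of On | App of nat & term & term & term.

Section Hull.
Variables (X : set On) (F : nat -> On -> On -> On -> On).

Fixpoint term_over (t : term) : Prop :=
  match t with
  | Leaf x => X x
  | App _ t1 t2 t3 => [/\ term_over t1, term_over t2 & term_over t3]
  end.

Fixpoint term_eval (t : term) : On :=
  match t with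
  | Leaf x => x
  | App n t1 t2 t3 => F n (term_eval t1) (term_eval t2) (term_eval t3)
  end.

Definition hull : set On := term_eval @` term_over.

Lemma sub_hull : X `<=` hull.
Proof. by move=> x Xx; exists (Leaf x). Qed.

Lemma hull_closed n x y z : hull x -> hull y -> hull z -> hull (F n x y z).
Proof. by move=> [t1 ? <-] [t2 ? <-] [t3 ? <-]; exists (App n t1 t2 t3). Qed.

Lemma card_hull k : infinite_set (seg k) -> X #<= seg k -> hull #<= seg k.
Proof.
move=> infk /card_le_exinj[g [gX ginj]]; have /card_le_exinj[p [pk pinj]] := card_segX infk.
have /card_le_exinj[e [ek' einj']] := (infiniteP (seg k)).1 infk.
have ek n : seg k (e n) by exact: ek'.
have einj m n : e m = e n -> m = n by exact: einj'.
have [P [Pk Pinj]] : exists P : On -> On -> On,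
    (forall x y, seg k x -> seg k y -> seg k (P x y)) /\
    forall x y x' y', seg k x -> seg k y -> seg k x' -> seg k y' ->
    P x y = P x' y' -> x = x' /\ y = y'.
  exists (fun x y => p (x, y)); split=> [x y xk yk|x y x' y' xk yk xk' yk']; first exact: pk.
  by move=> /(pinj (x, y) (x', y') (conj xk yk) (conj xk' yk'))[].
pose fix code t := match t with
  | Leaf x => P (e 0%N) (g x)
  | App n t1 t2 t3 => P (e 1%N) (P (e n) (P (code t1) (P (code t2) (code t3))))
  end.
have Qk n x y z : seg k x -> seg k y -> seg k z -> seg k (P (e n) (P x (P y z))).
  by move=> xk yk zk; apply: (Pk _ _ (ek n)); apply: (Pk _ _ xk); exact: Pk.
have codek t : term_over t -> seg k (code t).
  elim: t => [x /= Xx|n t1 IH1 t2 IH2 t3 IH3 /= [/IH1 ? /IH2 ? /IH3 ?]].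
    by apply: Pk (ek _) _; exact: gX.
  by apply: Pk (ek _) _; exact: Qk.
apply: card_le_trans (card_image_le _ _) _.
apply: (@card_le_inj _ _ _ _ code) => //.
elim=> [x|n t1 IH1 t2 IH2 t3 IH3] [x'|n' u1 u2 u3] /=.
- by move=> Xx Xx' /(Pinj _ _ _ _ (ek _) (gX _ Xx) (ek _) (gX _ Xx'))[_ /ginj ->].
- move=> Xx [/codek c1 /codek c2 /codek c3].
  by move=> /(Pinj _ _ _ _ (ek _) (gX _ Xx) (ek _) (Qk _ _ _ _ c1 c2 c3))[/einj].
- move=> [/codek c1 /codek c2 /codek c3] Xx.
  by move=> /(Pinj _ _ _ _ (ek _) (Qk _ _ _ _ c1 c2 c3) (ek _) (gX _ Xx))[/einj].
move=> [T1 T2 T3] [U1 U2 U3].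
have c1 := codek _ T1; have c2 := codek _ T2; have c3 := codek _ T3.
have d1 := codek _ U1; have d2 := codek _ U2; have d3 := codek _ U3.
have c23 := Pk _ _ c2 c3; have d23 := Pk _ _ d2 d3.
move=> /(Pinj _ _ _ _ (ek _) (Qk _ _ _ _ c1 c2 c3) (ek _) (Qk _ _ _ _ d1 d2 d3))[_].
move=> /(Pinj _ _ _ _ (ek _) (Pk _ _ c1 c23) (ek _) (Pk _ _ d1 d23))[/einj -> +].
move=> /(Pinj _ _ _ _ c1 c23 d1 d23)[/(IH1 _ T1 U1) -> +].
by move=> /(Pinj _ _ _ _ c2 c3 d2 d3)[/(IH2 _ T2 U2) -> /(IH3 _ T3 U3) ->].
Qed.

End Hull.

Lemma is_liminfP d (T : orderType d) (t : On) (f : On -> T) (l : T) :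
  well_founded (fun x y : T => x < y) ->
  is_liminf t f l <->
  (forall q, q < l -> exists2 s, s < t & forall r, s <= r -> r < t -> q < f r) /\
  (forall s, s < t -> exists r, [/\ s <= r, r < t & f r <= l]).
Proof.
move=> wfT; have inf_ex s : s < t ->
    exists r, [/\ s <= r, r < t & infimums (f @` [set r | s <= r < t]) (f r)].
  move=> st; have [|_ [r /= /andP[sr rt] <-] lb] := @wf_min _ _ (f @` [set r | s <= r < t]) wfT.
    by exists (f s); exists s => //=; rewrite lexx st.
  by exists r; split=> //; split=> // m; apply; exists r => //=; rewrite sr rt.
split=> [[ubl lbl]|[ha hb]].
  split=> [q ql|s st].
    have /existsNP[m /not_implyP[[s st [mlb _]] /negP]] :
        ~ ubound [set m | exists2 s, s < t & infimums (f @` [set r | s <= r < t]) m] q.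
      by move=> /lbl; rewrite leNgt ql.
    rewrite -ltNge => qm; exists s => // r sr rt; apply: lt_le_trans qm _.
    by apply: mlb; exists r => //=; rewrite sr rt.
  have [r [sr rt fr]] := inf_ex s st; exists r; split=> //.
  by apply: ubl; exists s.
split=> [m [s st [mlb _]]|u ubu].
  have [r [sr rt fr]] := hb s st; apply: le_trans fr.
  by apply: mlb; exists r => //=; rewrite sr rt.
rewrite leNgt; apply/negP => /ha[s st hs]; have [r [sr rt fr]] := inf_ex s st.
by have := hs r sr rt; rewrite ltNge => /negP; apply; apply: ubu; exists s.
Qed.

(** * Collapses and simulations *)

Lemma lt_in_wf (A : set On) : well_founded (fun y x : On => A y /\ y < x).
Proof.
move=> x; elim/(well_founded_ind on_wf): x => x IH.
by constructor=> y [_ /IH].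
Qed.

(* The order isomorphism from [A] onto an initial segment of [[b, oo)],
   extended to all ordinals. *)
Definition coll (A : set On) (b : On) : On -> On := rank (@lt_in_wf A) b.

Section Coll.
Variables (A : set On) (b : On).

Let smallA x : is_small [set y | A y /\ y < x].
Proof. by apply: sub_small (small_seg x) => y []. Qed.

Lemma coll_base x : b <= coll A b x.
Proof. exact: rank_base. Qed.

Lemma coll_lt x y : A x -> x < y -> coll A b x < coll A b y.
Proof. by move=> Ax xy; exact: rank_lt. Qed.

Lemma coll_le x y : x <= y -> coll A b x <= coll A b y.
Proof.
move=> xy; apply: rank_le => // [|z [Az zx]]; first exact: coll_base.
by apply: coll_lt => //; exact: lt_le_trans xy.
Qed.

Lemma coll_leE x y : A y -> (coll A b x <= coll A b y) = (x <= y).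
Proof.
move=> Ay; apply/idP/idP; last exact: coll_le.
by apply: contraTT; rewrite -!ltNge; exact: coll_lt.
Qed.

Lemma coll_ltE x y : A x -> (coll A b x < coll A b y) = (x < y).
Proof. by move=> Ax; rewrite !ltNge coll_leE. Qed.

Lemma coll_inj x y : A x -> A y -> coll A b x = coll A b y -> x = y.
Proof.
by move=> Ax Ay xy; apply/eqP; rewrite eq_le -coll_leE // -(coll_leE y) // xy lexx.
Qed.

Lemma coll_onto x c : b <= c -> c < coll A b x ->
  exists y, [/\ A y, y < x & coll A b y = c].
Proof.
move=> bc /(rank_onto smallA _ bc)[|y [Ay yx] <-]; last by exists y.
by move=> {}y u z [Au uy] [Ay yz]; split=> //; exact: lt_trans yz.
Qed.

Lemma collS x : A x -> coll A b (osucc x) = osucc (coll A b x).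
Proof.
move=> Ax; apply/eqP; rewrite eq_le osucc_le coll_ltE // lt_osucc lexx andbT.
apply: rank_le => // [|z [Az]]; last by rewrite !lt_osucc; exact: coll_le.
by rewrite (le_trans (coll_base x)) // ltW // lt_osucc.
Qed.

Lemma coll_min m : lbound A m -> coll A b m = b.
Proof.
move=> Am; apply/eqP; rewrite eq_le coll_base andbT; apply: rank_le => // z [/Am mz].
by rewrite ltNge mz.
Qed.

Lemma coll_id x : lbound A b -> b <= x -> (forall y, b <= y -> y < x -> A y) ->
  coll A b x = x.
Proof.
move=> lb; elim/(well_founded_ind on_wf): x => x IH bx Ax.
have IH' z : b <= z -> z < x -> coll A b z = z.
  by move=> bz zx; apply: IH => // y ? yz; apply: Ax => //; exact: lt_trans zx.
apply/eqP; rewrite eq_le; apply/andP; split.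
  by apply: rank_le => // z [/lb bz zx]; rewrite -/(coll A b z) IH'.
rewrite leNgt; apply/negP => cx; have bc := coll_base x.
by have := coll_lt (Ax _ bc cx) cx; rewrite IH' ?ltxx.
Qed.

Lemma coll_neqS x c : (forall y, A y -> y < x -> A (osucc y)) ->
  (forall y, x <> osucc y) -> b <= c -> coll A b x <> osucc c.
Proof.
move=> AS xS bc xc; have [|y [Ay yx yc]] := @coll_onto x c bc.
  by rewrite xc lt_osucc.
have : osucc y < x by rewrite lt_neqAle osucc_le yx andbT; apply/eqP/nesym.
by rewrite -coll_ltE; [rewrite collS // yc xc ltxx|exact: AS].
Qed.

End Coll.

Lemma move_headL q : move_head Left (osucc q) = q.
Proof. by rewrite /move_head; case: xgetP => [x _ /= /osucc_inj //|/(_ q)[]]. Qed.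

Lemma move_headL0 x : (forall q, x <> osucc q) -> move_head Left x = ozero.
Proof. by move=> xS; rewrite /move_head; case: xgetP => // y _ /= /esym/xS. Qed.

Lemma coll_move (B : set On) a b m x : B a -> lbound B a ->
  (forall y, B y -> B (osucc y)) -> (B ozero -> b = ozero) ->
  B x -> B (move_head m x) ->
  move_head m (coll B b x) = coll B b (move_head m x).
Proof.
move=> Ba lb BS B0 Bx; case: m => [|//|_]; last by rewrite /= collS.
have [[q xq]|xS] := pselect (exists q, x = osucc q).
  by move: Bx; rewrite xq move_headL => Bx Bq; rewrite collS // move_headL.
have {}xS q : x <> osucc q by move=> xq; apply: xS; exists q.
rewrite (move_headL0 xS) => b0; have {}B0 := B0 b0.
rewrite (@coll_min B b ozero) => [|y _]; last exact: ozero_le.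
rewrite B0; apply: move_headL0 => q; apply: coll_neqS => // [y By _|].
  exact: BS.
exact: ozero_le.
Qed.

Definition onat (n : nat) : On := iter n osucc ozero.

Lemma onat_le m n : (onat m <= onat n) = (m <= n)%N.
Proof.
elim: m n => [|m IH] [|n] /=; rewrite ?ozero_le //.
  by rewrite leNgt (le_lt_trans (ozero_le (onat m))) // lt_osucc.
by rewrite osucc_le lt_osucc IH.
Qed.

Lemma onat_lt m n : (onat m < onat n) = (m < n)%N.
Proof. by rewrite ltNge onat_le -ltnNge. Qed.

Lemma onat_onto n x : x < onat n -> exists2 m, (m < n)%N & x = onat m.
Proof.
elim: n => [|n IH] /=; first by rewrite ltNge ozero_le.
rewrite lt_osucc le_eqVlt => /orP[/eqP ->|/IH[m mn ->]]; first by exists n.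
by exists m => //; exact: ltnW.
Qed.

Inductive field := State | Shead | Scratch of On | Ihead.

Definition obs (P : program) (c : config P) (k : field) : On :=
  match k with
  | State => onat (state c)
  | Shead => shead c
  | Scratch p => onat (scratch c p)
  | Ihead => ihead c
  end.

Lemma obs_inj P (c d : config P) : (forall k, obs c k = obs d k) -> c = d.
Proof.
have onat_inj m n : onat m = onat n -> m = n.
  by move=> mn; apply/eqP; rewrite eqn_leq -!onat_le mn lexx.
case: c d => [q i s x] [q' i' s' x'] H; congr Config.
- by have := H State => /= /onat_inj /val_inj.
- exact: H Ihead.
- exact: H Shead.
- apply/funext => p; have := H (Scratch p) => /= /onat_inj.
  by case: (x p) (x' p) => [] [].
Qed.

Lemma obs_limit P w (C : On -> config P) : is_computation w C ->
  forall t k, olimit t -> is_liminf t (fun s => obs (C s) k) (obs (C t) k).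
Proof.
move=> [_ _ Cq Ci Cs Cx] t k lt; case: k => [||p|] /=; [|exact: Cs| |exact: Ci].
- have /is_liminfP := Cq t lt => /(_ (@ord_wf _))[ha hb].
  apply/is_liminfP; first exact: on_wf; split=> [q /onat_onto[m mt ->]|s /hb[r [? ? le]]].
    have [s st hs] := ha (Ordinal (ltn_trans mt (ltn_ord _))) mt.
    by exists s => // r sr rt; rewrite onat_lt; exact: hs.
  by exists r; rewrite onat_le.
- have /is_liminfP := Cx t p lt => /(_ bool_wf)[ha hb].
  apply/is_liminfP; first exact: on_wf; split=> [q|s /hb[r [? ? le]]].
    case E: (scratch (C t) p) => /onat_onto[] // [] // _ ->.
    have [|s st hs] := ha false; first by rewrite E.
    by exists s => // r sr /(hs _ sr); rewrite onat_lt; case: (scratch _ _).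
  exists r; split=> //; rewrite onat_le; move: le.
  by case: (scratch _ _); case: (scratch _ _).
Qed.

Definition shift P (f : On -> On) (c : config P) : config P :=
  Config (state c) (f (ihead c)) (shead c) (scratch c).

Section Simulation.
Variables (P : program) (w v : word) (C D : On -> config P).
Hypotheses (Cw : is_computation w C) (Dv : is_computation v D).
Variables (A : set On) (t1 u : On) (B : set On) (a b : On).
Hypotheses (At1 : A t1) (lbA : lbound A t1) (Ba : B a) (lbB : lbound B a).
Hypothesis AS : forall s t, A s -> A t -> s < t -> A (osucc s).
Hypothesis AP : forall s, A (osucc s) -> t1 <= s -> A s.
Hypothesis BS : forall x, B x -> B (osucc x).
Hypothesis B0 : B ozero -> b = ozero.
Hypothesis AB : forall t, A t -> B (ihead (C t)).
Hypothesis lim_gt : forall t k q, A t -> t1 < t -> olimit t ->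
  q < obs (C t) k -> (k = Ihead -> B q) ->
  exists s, [/\ A s, s < t & forall r, A r -> s <= r -> r < t -> q < obs (C r) k].
Hypothesis lim_le : forall t k s, A t -> olimit t -> A s -> s < t ->
  exists r, [/\ A r, s <= r, r < t & obs (C r) k <= obs (C t) k].
Hypothesis same_input : forall x, B x -> input_tape v (coll B b x) = input_tape w x.
Hypothesis start : D u = shift (coll B b) (C t1).

Lemma step_shift (c : config P) : B (ihead c) -> B (ihead (step w c)) ->
  step v (shift (coll B b) c) = shift (coll B b) (step w c).
Proof.
rewrite /step /= => Bc; rewrite same_input //.
case: instr => [[[[q x] mi] ms] /= Bm|//].
by rewrite /shift /= (coll_move Ba lbB).
Qed.

Lemma obs_shift (c : config P) k : obs (shift (coll B b) c) k =
  if k is Ihead then coll B b (obs c k) else obs c k.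
Proof. by case: k. Qed.

Lemma olimit_coll t : A t -> t1 < t -> olimit t -> olimit (coll A u t).
Proof.
move=> At t1t lt; have ut : u < coll A u t.
  by rewrite (le_lt_trans (coll_base A u t1)) // coll_ltE.
split=> [|c ct]; first exact: le_lt_trans (ozero_le _) ut.
have [uc|cu] := leP u c; last by rewrite (le_lt_trans _ ut) // osucc_le.
have [s [As st <-]] := coll_onto uc ct; rewrite -collS // coll_ltE; last exact: AS st.
exact: lt.2.
Qed.

Lemma simulation t : A t -> D (coll A u t) = shift (coll B b) (C t).
Proof.
elim/(well_founded_ind on_wf): t => t IH At.
have [t1t|] := ltP t1 t; last first.
  move=> tt1; have -> : t = t1 by apply/eqP; rewrite eq_le tt1 lbA.
  by rewrite coll_min.
have [t0|[s ts]|lt] := on_cases t.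
- by move: t1t; rewrite t0 ltNge ozero_le.
- subst t; rewrite lt_osucc in t1t; have As := AP At t1t.
  rewrite collS // (computationS Dv) IH ?lt_osucc // (computationS Cw).
  by apply: step_shift; [exact: AB|rewrite -(computationS Cw); exact: AB].
apply: obs_inj => k; apply: is_liminf_inj (obs_limit Dv k (olimit_coll At t1t lt)) _.
have onto s : s < coll A u t -> exists s', [/\ A s', s' < t & s <= coll A u s'].
  move=> st; have [us|su] := leP u s; last first.
    by exists t1; split=> //; exact: le_trans (ltW su) (coll_base _ _ _).
  by have [s' [? ? <-]] := coll_onto us st; exists s'.
apply/is_liminfP; first exact: on_wf; split=> [q|s /onto[s' [As' s't ss']]].
  rewrite obs_shift => qt.
  have [s [As st hs]] : exists s, [/\ A s, s < t & forall r, A r -> s <= r -> r < t ->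
      q < obs (shift (coll B b) (C r)) k].
    case: k qt => [||p|] qt; [exact: (lim_gt At t1t lt qt)|exact: (lim_gt At t1t lt qt)|
      exact: (lim_gt (k := Scratch p) At t1t lt qt)|].
    have [bq|qb] := leP b q; last first.
      by exists t1; split=> // r _ _ _; exact: lt_le_trans qb (coll_base _ _ _).
    have [x [Bx xt <-]] := coll_onto bq qt.
    have [s [As st hs]] := lim_gt At t1t lt xt (fun=> Bx).
    by exists s; split=> // r Ar sr rt; rewrite /= coll_ltE //; exact: hs.
  exists (coll A u s) => [|r sr rt]; first by rewrite coll_ltE.
  have [r' [Ar' r't r'r]] := coll_onto (le_trans (coll_base _ _ _) sr) rt.
  by rewrite -r'r IH //; apply: hs => //; rewrite -(coll_leE u s Ar') r'r.
have [r [Ar s'r rt le]] := lim_le k At lt As' s't.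
exists (coll A u r); rewrite coll_ltE // IH //; split=> //.
  by apply: le_trans ss' _; exact: coll_le.
by rewrite !obs_shift; case: k le => // le; exact: coll_le.
Qed.

End Simulation.

(** * Loops repeat forever *)

Lemma input_tape_out w x : wlen w <= x -> input_tape w x = false.
Proof. by move=> wx; rewrite /input_tape; case: pselect => // xw; move: wx; rewrite leNgt xw. Qed.

Section Loop.
Variables (P : program) (w : word) (C : On -> config P).

Record loop (t1 t2 : On) : Prop := Loop {
  loop_lt : t1 < t2;
  loop_eq : forall k, k <> Ihead -> obs (C t2) k = obs (C t1) k;
  loop_ge : forall k r, t1 <= r -> r <= t2 -> obs (C t1) k <= obs (C r) k;
  loop_ihead : (wlen w <= ihead (C t1) /\ ozero < ihead (C t1)) \/
    ihead (C t2) = ihead (C t1)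
}.

Hypothesis Cw : is_computation w C.
Variables t1 t2 : On.
Hypothesis lp : loop t1 t2.

Let a := ihead (C t1).

(* The times from which the run on [t1, t2] is repeated, with input
   heads translated by the map [a + x |-> ihead (C s) + x]. *)
Let base s := [/\ t1 <= s, forall k, k <> Ihead -> obs (C s) k = obs (C t1) k,
  a <= ihead (C s) & (wlen w <= a /\ ozero < a) \/ ihead (C s) = a].

Let pass s := coll [set r | t1 <= r <= t2] s.

Let loop_simulation s r : base s -> t1 <= r <= t2 ->
  C (pass s r) = shift (coll [set x | a <= x] (ihead (C s))) (C r).
Proof.
have lt12 := ltW (loop_lt lp).
move=> [t1s eq_s a_s ih_s] rt; apply: (simulation (w := w) Cw Cw (t1 := t1) (a := a)) => //=.
- by rewrite lexx lt12.
- by move=> x /andP[].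
- move=> x y /andP[t1x _] /andP[_ yt2] xy; rewrite (le_trans t1x) ?osucc_le.
    exact: lt_le_trans yt2.
  by rewrite ltW // lt_osucc.
- by move=> x /andP[_ xt2] t1x; rewrite t1x ltW // -osucc_le.
- by move=> x ax; rewrite (le_trans ax) // ltW // lt_osucc.
- move=> a0; have {}a0 : a = ozero by apply/eqP; rewrite eq_le a0 ozero_le.
  by case: ih_s => [[_]|->//]; rewrite a0 ltxx.
- by move=> x /andP[t1x xt2]; exact: (loop_ge lp Ihead t1x xt2).
- move=> t k q /andP[_ tt2] t1t lt qt _.
  have /is_liminfP := obs_limit Cw k lt => /(_ on_wf)[/(_ q qt)[s0 s0t hs] _].
  exists (Order.max s0 t1); split=> [||x _].
    by rewrite le_max lexx orbT /= ge_max lt12 ltW ?(lt_le_trans s0t).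
    by rewrite gt_max s0t.
  by rewrite ge_max => /andP[s0x _]; exact: hs.
- move=> t k x /andP[t1t tt2] lt /andP[t1x _] xt.
  have /is_liminfP := obs_limit Cw k lt => /(_ on_wf)[_ /(_ x xt)[y [xy yt le]]].
  by exists y; rewrite (le_trans t1x xy) (le_trans (ltW yt) tt2).
- move=> x ax; case: ih_s => [[wa _]|->]; last first.
    by rewrite coll_id // => y [].
  by rewrite !input_tape_out ?(le_trans wa) // (le_trans a_s) // coll_base.
- apply: obs_inj => k; rewrite obs_shift.
  by case: k => [||p|] /=; rewrite ?coll_min //;
    [exact: (eq_s State)|exact: (eq_s Shead)|exact: (eq_s (Scratch p))].
Qed.

Let lt_pass s : s < pass s t2.
Proof.
have lt12 := loop_lt lp.
rewrite (le_lt_trans (coll_base [set r | t1 <= r <= t2] s t1)) // coll_ltE //=.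
by rewrite lexx ltW.
Qed.

Let base_pass s : base s -> base (pass s t2).
Proof.
move=> bs; have [t1s eq_s a_s ih_s] := bs; have lt12 := ltW (loop_lt lp).
have E := loop_simulation bs (_ : t1 <= t2 <= t2); split=> [|k kI||].
- exact: le_trans (ltW (lt_pass _)).
- by rewrite E ?lt12 ?lexx // obs_shift; case: k kI => // [||p] kI; rewrite (loop_eq lp).
- by rewrite E ?lt12 ?lexx //= (le_trans a_s) // coll_base.
case: ih_s => [|ih_s]; first by left.
have [[]|ih2] := loop_ihead lp; first by left.
by right; rewrite E ?lt12 ?lexx //= ih2 ih_s coll_min.
Qed.

Let pass_onto s c : s <= c -> c < pass s t2 -> exists2 r, t1 <= r <= t2 & c = pass s r.
Proof. by move=> sc /(coll_onto sc)[r [/= rt _ <-]]; exists r. Qed.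

Lemma loop_forever t : t1 <= t -> exists r, [/\ t1 <= r, r <= t2,
  forall k, k <> Ihead -> obs (C t) k = obs (C r) k & ihead (C t1) <= ihead (C t)].
Proof.
have lt12 := loop_lt lp.
have base1 : base t1 by split=> //; right.
elim/(well_founded_ind on_wf): t => t IH t1t.
have [m mub mmin] : exists2 m, (forall s, base s -> s <= t -> s <= m) &
    forall m', (forall s, base s -> s <= t -> s <= m') -> m <= m'.
  by apply: on_min; exists t.
have mt : m <= t by exact: mmin.
have t1m : t1 <= m by exact: mub.
suff bm : base m.
  have [||r rt tE] := @pass_onto m t => //.
    rewrite ltNge; apply/negP => /(mub _ (base_pass bm)).
    by rewrite leNgt lt_pass.
  have [_ _ a_m _] := bm; exists r; rewrite tE loop_simulation //.
  case/andP: rt => t1r rt2; split=> //.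
    by move=> k; rewrite obs_shift; case: k.
  by apply: le_trans a_m _; rewrite coll_base.
apply: contrapT => nbm.
have cof c : c < m -> exists s, [/\ base s, c < s & s < m].
  move=> cm; have /existsNP[s /not_implyP[bs /not_implyP[st /negP]]] :
      ~ forall s, base s -> s <= t -> s <= c.
    by move=> /mmin; rewrite leNgt cm.
  rewrite -ltNge => cs; exists s; split=> //; rewrite lt_neqAle mub // andbT.
  by apply/eqP => sm; apply: nbm; rewrite -sm.
have t1_lt_m : t1 < m by rewrite lt_neqAle t1m andbT; apply/eqP => t1E; apply: nbm; rewrite -t1E.
have lm : olimit m.
  split=> [|c /cof[s [_ cs sm]]]; first exact: le_lt_trans (ozero_le _) t1_lt_m.
  by apply: le_lt_trans sm; rewrite osucc_le.
have ge k r : t1 <= r -> r < m -> obs (C t1) k <= obs (C r) k.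
  move=> t1r rm; have [r' [t1r' r't2 eqr ar]] := IH r (lt_le_trans rm mt) t1r.
  case: (pselect (k = Ihead)) => [->//|kI].
  by rewrite (eqr _ kI); exact: (loop_ge lp k).
have lim k : (forall s, base s -> obs (C s) k = obs (C t1) k) -> obs (C m) k = obs (C t1) k.
  move=> hk; apply: is_liminf_inj (obs_limit Cw k lm) _.
  apply/is_liminfP; first exact: on_wf; split=> [q qt|s /cof[r [br sr rm]]].
    by exists t1 => // r t1r rm; exact: lt_le_trans (ge _ _ t1r rm).
  by exists r; rewrite (hk _ br) ltW.
apply: nbm; split=> // [k kI||].
- by apply: lim => s [_ + _ _]; exact.
- rewrite leNgt; apply/negP => lta.
  have /is_liminfP := obs_limit Cw Ihead lm => /(_ on_wf)[_ /(_ t1 t1_lt_m)[r [t1r rm]]].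
  by move=> /le_lt_trans/(_ lta); rewrite ltNge (ge Ihead).
- case: (pselect (wlen w <= a /\ ozero < a)) => [|na]; first by left.
  by right; apply: (lim Ihead) => s [_ _ _ []].
Qed.

End Loop.

(** * Existence of loops *)

Lemma eventually_ge (f : On -> On) u :
  (forall l, l < u -> exists s, forall r, s <= r -> f r <> l) ->
  exists s, forall r, s <= r -> u <= f r.
Proof.
move=> H; have {}H l : exists s, l < u -> forall r, s <= r -> f r <> l.
  by case: (pselect (l < u)) => [/H[s hs]|nlu]; [exists s|exists l].
have [s hs] := choice H.
have [s0 s0P] := small_bounded (small_image s (small_seg u)).
exists s0 => r s0r; rewrite leNgt; apply/negP => fru.
by apply: (hs _ fru r) => //; rewrite (le_trans _ s0r) // ltW // s0P //; exists (f r).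
Qed.

Lemma liminf_On_dichotomy (f : On -> On) :
  (exists l s0, (forall r, s0 <= r -> l <= f r) /\ forall s, exists2 r, s <= r & f r = l) \/
  (forall u, exists s, forall r, s <= r -> u <= f r).
Proof.
have notcof l : ~ (forall s, exists2 r, s <= r & f r = l) ->
    exists s, forall r, s <= r -> f r <> l.
  by move=> /existsNP[s hs]; exists s => r sr frl; apply: hs; exists r.
have [ex|nex] := pselect (exists l, forall s, exists2 r, s <= r & f r = l); last first.
  by right=> u; apply: eventually_ge => l _; apply: notcof => hl; apply: nex; exists l.
left; have [l hl lmin] := on_min ex; exists l.
have [|s0 hs0] := @eventually_ge f l; last by exists s0.
by move=> l' l'l; apply: notcof => /lmin; rewrite leNgt l'l.
Qed.

Lemma omega_limit (g : On -> On) s : (forall x, x < g x) ->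
  exists t, [/\ s < t, olimit t & forall c, c < t -> exists c', [/\ s <= c', c <= c' & g c' < t]].
Proof.
move=> lt_g; pose h n := iter n g s.
have smh : is_small (range h) by exists nat, h.
have [ht tmin] := strict_supP smh; set t := strict_sup _ in ht tmin.
have {}ht n : h n < t by apply: ht; exists n.
have sh n : s <= h n by elim: n => //= n /le_trans; apply; exact/ltW.
have cof c : c < t -> exists n, c <= h n.
  move=> ct; apply: contrapT => nex; move: ct; rewrite ltNge tmin // => _ [n _ <-].
  by rewrite ltNge; apply/negP => cn; apply: nex; exists n.
exists t; split=> [||c /cof[n cn]]; first exact: (ht 0%N).
  split=> [|c /cof[n cn]]; first exact: le_lt_trans (ozero_le _) (ht 0%N).
  by rewrite (le_lt_trans _ (ht n.+1)) // osucc_le (le_lt_trans cn) //=.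
by exists (h n); split=> //; exact: (ht n.+1).
Qed.

Lemma scratch_unvisited P w (C : On -> config P) p : is_computation w C ->
  (forall t, shead (C t) <> p) -> forall t, scratch (C t) p = false.
Proof.
move=> Cw np; elim/(well_founded_ind on_wf) => t IH.
have [->|[s ts]|lt] := on_cases t; first by rewrite (computation0 Cw).
  have := IH s; rewrite ts (computationS Cw) /step lt_osucc lexx => /(_ isT) sp.
  case: instr => [[[[q x] mi] ms] /=|//].
  by case: eqP => // /esym/np.
have /is_liminfP := computation_scratch Cw p lt => /(_ bool_wf)[ha _].
case E: (scratch (C t) p) => //; have [|s st /(_ s (lexx s) st)] := ha false; first by rewrite E.
by rewrite IH.
Qed.

Lemma loop_ex P w (C : On -> config P) u : is_computation w C ->
  (forall t, shead (C t) < u) -> exists t1 t2, loop w C t1 t2.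
Proof.
move=> Cw Cu.
pose inf := forall x, exists s, forall r, s <= r -> x <= ihead (C r).
pose K := [set State; Shead] `|` (Scratch @` seg u) `|` [set k | k = Ihead /\ ~ inf].
have smK : is_small K.
  apply: smallU; [apply: smallU|]; [|exact: small_image (small_seg u)|].
    by exists bool, (fun b => if b then State else Shead) => _ [] ->; [exists true|exists false].
  by exists unit, (fun=> Ihead) => _ [-> _]; exists tt.
have bdd k : K k -> exists ls : On * On, (forall r, ls.2 <= r -> ls.1 <= obs (C r) k) /\
    forall s, exists2 r, s <= r & obs (C r) k = ls.1.
  move=> Kk; have [[l [s [? ?]]]|H] := liminf_On_dichotomy (fun t => obs (C t) k).
    by exists (l, s).
  case: Kk H => [[[->|->]|[p _ <-]]|[-> ninf]] H; last by case: ninf.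
  - have [s /(_ s (lexx s))] := H (onat (nstate P).+1).
    by rewrite onat_le leqNgt ltn_ord.
  - by have [s /(_ s (lexx s))] := H u; rewrite leNgt Cu.
  - have [s /(_ s (lexx s))] := H (onat 2).
    by rewrite onat_le; case: (scratch _ _).
have {}bdd k : exists ls : On * On, K k -> (forall r, ls.2 <= r -> ls.1 <= obs (C r) k) /\
    forall s, exists2 r, s <= r & obs (C r) k = ls.1.
  by case: (pselect (K k)) => [/bdd[ls ?]|?]; [exists ls|exists (u, u)].
have [ls lsP] := choice bdd; pose l k := (ls k).1.
have [T0 T0P] := small_bounded (small_image (fun k => (ls k).2) smK).
have [T1 T1P] : exists T, inf -> forall r, T <= r -> osucc (wlen w) <= ihead (C r).
  by case: (pselect inf) => [/(_ (osucc (wlen w)))[T ?]|?]; [exists T|exists u].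
pose T := Order.max T0 T1.
have ge_l k r : K k -> T <= r -> l k <= obs (C r) k.
  move=> Kk; rewrite ge_max => /andP[Tr _]; apply: (lsP k Kk).1.
  by apply: le_trans Tr; apply/ltW/T0P; exists k.
have [s|g gP] := @choice _ _ (fun s y => [/\ s < y,
    forall k, K k -> exists r, [/\ s <= r, r < y & obs (C r) k = l k] &
    inf -> forall r, y <= r -> ihead (C s) < ihead (C r)]).
  have hit k : exists r, K k -> s <= r /\ obs (C r) k = l k.
    by case: (pselect (K k)) => [/lsP[_ /(_ s)[r ? ?]]|?]; [exists r|exists s].
  have [r rP] := choice hit; have [y yP] := small_bounded (small_image r smK).
  have [z zP] : exists z, inf -> forall r, z <= r -> ihead (C s) < ihead (C r).
    case: (pselect inf) => [/(_ (osucc (ihead (C s))))[z zP]|?]; last by exists s.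
    by exists z => _ x /zP; rewrite osucc_le.
  exists (Order.max (osucc s) (Order.max y z)); split=> [|k Kk|/zP {}zP x].
  - by rewrite lt_max lt_osucc lexx.
  - have [sr rl] := rP k Kk; exists (r k); split=> //.
    by rewrite !lt_max yP ?orbT //; exists k.
  - by rewrite !ge_max => /and3P[_ _ /zP].
have stable s : T <= s -> exists t, [/\ s < t, forall k, K k -> obs (C t) k = l k &
    forall r, t <= r -> ihead (C t) <= ihead (C r)].
  move=> Ts; have [|t [st lt cof]] := @omega_limit g s; first by move=> x; case: (gP x).
  have tl k : K k -> obs (C t) k = l k.
    move=> Kk; apply: is_liminf_inj (obs_limit Cw k lt) _.
    apply/is_liminfP; first exact: on_wf; split=> [q ql|c /cof[c' [_ cc' gt]]].
      by exists s => // r sr _; apply: lt_le_trans ql (ge_l _ _ Kk _); exact: le_trans sr.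
    have [_ /(_ k Kk)[r [c'r rg rl]] _] := gP c'.
    by exists r; rewrite (le_trans cc') // (lt_trans rg) // rl.
  exists t; split=> // r tr.
  case: (pselect inf) => [hinf|ninf]; last first.
    have KI : K Ihead by right.
    by have := tl _ KI => /= ->; apply: (ge_l Ihead) => //;
      rewrite (le_trans Ts) // (le_trans (ltW st)).
  rewrite leNgt; apply/negP => ihr.
  have /is_liminfP := obs_limit Cw Ihead lt => /(_ on_wf)[/(_ _ ihr)[s1 s1t hs1] _].
  have [c [_ s1c gct]] := cof _ s1t; have [cg _ /(_ hinf r)] := gP c.
  rewrite (le_trans (ltW gct) tr) => /(_ isT); rewrite ltNge => /negP; apply.
  by apply/ltW/hs1 => //; exact: lt_trans gct.
have [t1 [Tt1 l1 ih1]] := stable T (lexx T).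
have [t2 [t12 l2 ih2]] := stable t1 (ltW Tt1).
have outK k : ~ K k -> k <> Ihead -> forall r, obs (C r) k = onat false.
  case: k => [||p|] // nK _ r; [by case: nK; left; left; left|by case: nK; left; left; right|].
  congr onat; rewrite /= (@scratch_unvisited _ w) // => t pE; apply: nK.
  by left; right; exists p => //; rewrite -pE; exact: Cu.
exists t1, t2; split=> // [k kI|k r t1r rt2|].
- by case: (pselect (K k)) => [Kk|nK]; [rewrite l1 ?l2|rewrite !outK].
- case: (pselect (k = Ihead)) => [->|kI]; first exact: ih1.
  case: (pselect (K k)) => [Kk|nK]; last by rewrite !outK.
  by rewrite l1 //; apply: ge_l => //; exact: le_trans (ltW Tt1) t1r.
- case: (pselect inf) => [hinf|ninf].
    have := T1P hinf t1; rewrite osucc_le => H; left; split.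
      by apply/ltW/H; apply: le_trans (ltW Tt1); rewrite le_max lexx orbT.
    apply: le_lt_trans (ozero_le (wlen w)) (H _).
    by apply: le_trans (ltW Tt1); rewrite le_max lexx orbT.
  have KI : K Ihead by right.
  by right; have := l1 _ KI; have := l2 _ KI => /= -> ->.
Qed.

(** * Collapsing a computation *)

Lemma move_head_le m x : move_head m x <= osucc x.
Proof.
have xS : x <= osucc x by rewrite ltW // lt_osucc.
case: m => //; have [[q ->]|nS] := pselect (exists q, x = osucc q).
  rewrite move_headL; apply: (@le_trans _ _ (osucc q)); by rewrite ltW // lt_osucc.
by rewrite move_headL0 ?ozero_le // => q xq; apply: nS; exists q.
Qed.

Lemma visited_down P w p q : visited P w p -> q < p -> visited P w q.
Proof.
set C := computation P w; have Cw : is_computation w C := is_computation_computation P w.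
move=> [t _ tp] qp; have [|m qm mmin] := @on_min [set t | q < shead (C t)].
  by exists t; rewrite /= tp.
have {mmin} lt_m s : s < m -> shead (C s) <= q.
  by move=> sm; rewrite leNgt; apply/negP => /mmin; rewrite leNgt sm.
have [m0|[s ms]|lm] := on_cases m.
- by move: qm; rewrite /= m0 (computation0 Cw) /= ltNge ozero_le.
- have sq : shead (C s) <= q by apply: lt_m; rewrite ms lt_osucc.
  exists s => //; apply/eqP; rewrite eq_le sq /=.
  move: qm; rewrite /= ms (computationS Cw) /step;
  case: instr => [[[[_ x] mi] ms'] /=|]; last exact: ltW.
  by move=> /lt_le_trans/(_ (move_head_le _ _)); rewrite lt_osucc.
- have /is_liminfP := computation_shead Cw lm => /(_ on_wf)[/(_ q qm)[s sm hs] _].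
  by have := lt_m s sm; rewrite leNgt hs.
Qed.

Lemma small_card_le (T U : pointedType) (A : set T) (B : set U) :
  A #<= B -> is_small B -> is_small A.
Proof.
move=> /card_le_exinj[f [fAB finj]] smB.
apply: sub_small (small_image (fun y => xget point [set x | A x /\ f x = y]) smB) => x Ax.
exists (f x); first exact: fAB.
by case: xgetP => [y -> [Ay /finj ->]|/(_ x)[]].
Qed.

Section Collapse.
Variables (P : program) (w : word) (kappa : On).
Hypotheses (kappa_inf : infinite_set (seg kappa)) (w_uses : uses P w kappa).

Let C := computation P w.
Let Cw : is_computation w C := is_computation_computation P w.
Let V := visited P w.

Let V_le : V #<= seg kappa.
Proof. by move: w_uses; rewrite /uses card_eq_le => /andP[]. Qed.

Variables t1 t2 : On.
Hypothesis lp : loop w C t1 t2.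

Let later_gt k t q := xget ozero [set s | s < t /\
  forall r, s <= r -> r < t -> q < obs (C r) k].

Let later_le k t s := xget ozero [set r | [/\ s <= r, r < t & obs (C r) k <= obs (C t) k]].

Let skolem (n : nat) (x y z : On) : On :=
  match n with
  | 0 => ozero
  | 1 => t1
  | 2 => t2
  | 3 => wlen w
  | 4 => osucc x
  | 5 => move_head Left x
  | 6 => ihead (C x)
  | 7 => xget ozero [set t | shead (C t) = x]
  | 8 => later_gt State x y
  | 9 => later_gt Shead x y
  | 10 => later_gt (Scratch z) x y
  | 11 => later_gt Ihead x y
  | 12 => later_le State x y
  | 13 => later_le Shead x y
  | 14 => later_le (Scratch z) x y
  | _ => later_le Ihead x y
  end.

Let H := hull V skolem.

Let HF n x y z : H x -> H y -> H z -> H (skolem n x y z).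
Proof. exact: hull_closed. Qed.

Let VH p : V p -> H p.
Proof. exact: sub_hull. Qed.

Let H0 : H ozero.
Proof.
have : V ozero by exists ozero => //; rewrite -/C (computation0 Cw).
exact: VH.
Qed.

Let Ht1 : H t1. Proof. exact: (HF 1 H0 H0 H0). Qed.
Let Ht2 : H t2. Proof. exact: (HF 2 H0 H0 H0). Qed.
Let Hlen : H (wlen w). Proof. exact: (HF 3 H0 H0 H0). Qed.
Let HS x : H x -> H (osucc x). Proof. by move=> Hx; exact: (HF 4 Hx H0 H0). Qed.
Let HP x : H (osucc x) -> H x.
Proof. by move=> Hx; have := HF 5 Hx H0 H0; rewrite /skolem move_headL. Qed.
Let Hihead t : H t -> H (ihead (C t)). Proof. by move=> Ht; exact: (HF 6 Ht H0 H0). Qed.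
Let Hvisit p : V p -> exists2 t, H t & shead (C t) = p.
Proof.
move=> Vp; have Hp := VH Vp; exists (skolem 7 p p p); first exact: HF.
by case: Vp => t _ tp; rewrite /skolem; case: xgetP => [s -> //|/(_ t)[]].
Qed.

Let Honat n : H (onat n).
Proof. by elim: n => // n; exact: HS. Qed.

Let blank p : ~ V p -> forall t, scratch (C t) p = false.
Proof. by move=> nVp; apply: scratch_unvisited Cw _ => t tp; apply: nVp; exists t. Qed.

Let H_lim_gt t k q : H t -> ozero < t -> olimit t -> q < obs (C t) k ->
  (k = Ihead -> H q) ->
  exists s, [/\ H s, s < t & forall r, H r -> s <= r -> r < t -> q < obs (C r) k].
Proof.
move=> Ht _ lt qt HIq.
have Hq : H q.
  case: k qt HIq => [/onat_onto[m _ -> _]|qt _|p /onat_onto[m _ -> _]|_];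
    [exact: Honat| |exact: Honat|exact].
  by apply: VH; apply: visited_down qt; exists t.
have Hs : H (later_gt k t q).
  case: k qt {HIq} => [||p|] qt;
    [exact: (HF 8 Ht Hq H0)|exact: (HF 9 Ht Hq H0)| |exact: (HF 11 Ht Hq H0)].
  have [Vp|nVp] := pselect (V p); first exact: (HF 10 Ht Hq (VH Vp)).
  by move: qt; rewrite /= blank //= ltNge ozero_le.
exists (later_gt k t q); move: Hs; rewrite /later_gt; case: xgetP => [s -> [st hs] Hs|no _].
  by split=> // r _; exact: hs.
have /is_liminfP := obs_limit Cw k lt => /(_ on_wf)[/(_ q qt)[s st hs] _].
by case: (no s).
Qed.

Let H_lim_le t k s : H t -> olimit t -> H s -> s < t ->
  exists r, [/\ H r, s <= r, r < t & obs (C r) k <= obs (C t) k].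
Proof.
move=> Ht lt Hs st.
have [[p [kp nVp]]|ok] := pselect (exists p, k = Scratch p /\ ~ V p).
  by exists s; rewrite kp /= !blank.
have Hr : H (later_le k t s).
  case: k ok => [||p|] ok;
    [exact: (HF 12 Ht Hs H0)|exact: (HF 13 Ht Hs H0)| |exact: (HF 15 Ht Hs H0)].
  have Vp : V p by apply: contrapT => nVp; apply: ok; exists p.
  exact: (HF 14 Ht Hs (VH Vp)).
exists (later_le k t s); move: Hr; rewrite /later_le; case: xgetP => [r -> [sr rt le] Hr|no _] //.
have /is_liminfP := obs_limit Cw k lt => /(_ on_wf)[_ /(_ s st)[r hr]].
by case: (no r).
Qed.

Let pi := coll H ozero.

Let pi0 : pi ozero = ozero.
Proof. by apply: coll_min => x _; exact: ozero_le. Qed.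

Let cword : word := @Word (pi (wlen w)) (fun c =>
  input_tape w (xget ozero [set x | H x /\ pi x = projT1 c])).

Let cword_input x : H x -> input_tape cword (pi x) = input_tape w x.
Proof.
move=> Hx; have [wx|xw] := leP (wlen w) x.
  by rewrite !input_tape_out //; exact: coll_le.
rewrite {1}/input_tape; case: pselect => [lt /=|[]]; last by rewrite /= coll_ltE.
by congr input_tape; case: xgetP => [y -> [Hy /(coll_inj Hy Hx) ->//]|/(_ x)[]].
Qed.

Let D := computation P cword.
Let Dv : is_computation cword D := is_computation_computation P cword.

Let D_pi t : H t -> D (pi t) = shift pi (C t).
Proof.
apply: (simulation (w := w) Cw Dv H0 _ H0) => //.
- by move=> x _; exact: ozero_le.
- by move=> x _; exact: ozero_le.
- by move=> s t' Hs _ _; exact: HS.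
- by move=> s /HP.
- by rewrite (computation0 Dv) (computation0 Cw) /shift /= -/pi pi0.
Qed.

Let pi_onto r t : H t -> r <= pi t -> exists r', [/\ H r', r' <= t & pi r' = r].
Proof.
move=> Ht; rewrite le_eqVlt => /orP[/eqP ->|rt]; first by exists t.
by have [r' [Hr' /ltW r't <-]] := coll_onto (ozero_le r) rt; exists r'.
Qed.

Let D_loop : loop cword D (pi t1) (pi t2).
Proof.
split=> [|k kI|k r t1r rt2|].
- by rewrite coll_ltE //; exact: loop_lt lp.
- by rewrite !D_pi // !obs_shift; case: k kI => // [||p] kI; exact: (loop_eq lp).
- have [r' [Hr' r't2 r'r]] := pi_onto Ht2 rt2; rewrite -r'r coll_leE // in t1r.
  have := loop_ge lp k t1r r't2; rewrite -r'r !D_pi // !obs_shift.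
  by case: k => //; exact: coll_le.
rewrite !D_pi //=; case: (loop_ihead lp) => [[wi i0]|->]; [left|by right].
by rewrite coll_le // -pi0 coll_ltE.
Qed.

Let visited_cword : visited P cword = V.
Proof.
apply/seteqP; split=> [_ [t _ <-]|p /Hvisit[t Ht <-]]; last first.
  by exists (pi t) => //; rewrite -/D D_pi.
have early r : r <= pi t2 -> V (shead (D r)).
  by move=> /(pi_onto Ht2)[r' [Hr' _ <-]]; rewrite D_pi //; exists r'.
have [tt2|t2t] := leP t (pi t2); first exact: early.
have [|r [_ rt2 eqr _]] := loop_forever Dv D_loop (t := t).
  by apply: ltW; apply: lt_trans t2t; exact: loop_lt D_loop.
by rewrite [shead _](eqr Shead) //; exact: early.
Qed.

Lemma small_word_uses : exists2 v, uses P v kappa & seg (wlen v) #<= seg kappa.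
Proof.
exists cword; first by rewrite /uses visited_cword.
have Hk : H #<= seg kappa by exact: card_hull.
apply: card_le_trans Hk; apply: card_le_trans (card_image_le pi H).
apply: subset_card_le => c /= /ltW /(pi_onto Hlen)[x [Hx _ <-]].
by exists x.
Qed.

End Collapse.

Theorem theorem3p2 (P : program) (kappa : On)
    (kappa_cardinal : is_cardinal kappa)
    (kappa_infinite : infinite_set (seg kappa))
    (w : word) (w_uses : uses P w kappa)
    (w_minimal : forall v : word, uses P v kappa -> wlen w <= wlen v) :
  seg (wlen w) #<= seg kappa.
Proof.
have V_le : visited P w #<= seg kappa by move: w_uses; rewrite /uses card_eq_le => /andP[].
have [u hu] := small_bounded (small_card_le V_le (small_seg kappa)).
have [|t1 [t2 lp]] := loop_ex (u := u) (is_computation_computation P w).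
  by move=> t; apply: hu; exists t.
have [v v_uses v_le] := small_word_uses kappa_infinite w_uses lp.
by apply: card_le_trans v_le; exact/subset_card_le/sub_seg/w_minimal.
Qed.
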